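(* Let $X$ be a non-empty set equipped with the discrete topology, and give $X^\omega$ the product topology. If $S \subseteq X^\omega$ is of second category, then for each infinite $J\subseteq \omega$ and each function $f:J\rightarrow\bigcup_{n\in\omega}X^n$ there exists a sequence $\{a_n\}_{n\in\omega}$ belonging to $S$ such that for infinitely many $i\in J$ the infinite sequence $\{a_{i+n}\}_{n\in\omega}$ extends the finite sequence $f(i)$.
   Context: $\omega$ denotes the set of natural numbers $\{0,1,2,\dots\}$, and $X^n$ is the set of finite sequences of length $n$ of elements of $X$. An infinite sequence $\{b_n\}_{n\in\omega}$ extends a finite sequence $(c_0,\dots,c_{m-1})\in X^m$ if $b_j=c_j$ for all $j<m$. A set is of second category if it is not of first category (not a countable union of nowhere dense sets). *)

(* Defs.v *)
From mathcomp Require Import all_boot.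
From mathcomp Require Import all_classical.
From mathcomp Require Import topology function_spaces.

Set Implicit Arguments.
Unset Strict Implicit.
Unset Printing Implicit Defensive.

Local Open Scope classical_set_scope.

Definition nowhere_dense (T : topologicalType) (A : set T) : Prop :=
  interior (closure A) = set0.

(* Finite unions are covered, since set0 is nowhere dense. *)
Definition first_category (T : topologicalType) (A : set T) : Prop :=
  exists F : nat -> set T,
    (forall n, nowhere_dense (F n)) /\ A = \bigcup_n F n.

Definition second_category (T : topologicalType) (A : set T) : Prop :=
  ~ first_category A.

(* The disjoint union of the X^n, n in nat, is represented by seq X. *)
Definition extends (X : Type) (b : nat -> X) (c : seq X) : Prop :=
  forall j : 'I_(size c), b j = tnth (in_tuple c) j.

(* Main.v *)
(* If every a in S had only finitely many good indices, S would be the union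
   over m of the sets of sequences in S with no good index i >= m. Each of them
   is nowhere dense: a basic open set fixes only finitely many coordinates, so
   beyond these there is an index i >= m of J at which f(i) can be inserted, and
   all sequences agreeing with the result far enough have i as a good index. *)
Require Import Defs.
From mathcomp Require Import all_boot.
From mathcomp Require Import all_classical.
From mathcomp Require Import topology function_spaces.
Local Open Scope classical_set_scope.

Lemma infinite_nat_unbounded (J : set nat) (n : nat) :
  infinite_set J -> exists2 i, J i & n <= i.
Proof.
move=> Jinf; apply: contrapT => noi; apply: Jinf.
apply: (@sub_finite_set _ _ `I_n); last exact: finite_II.
by move=> i Ji /=; rewrite ltnNge; apply/negP => ni; apply: noi; exists i.
Qed.

Lemma finite_nat_bounded (A : set nat) :
  finite_set A -> exists m, forall i, A i -> i < m.
Proof.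
move=> /finite_seqP[s ->]; exists (\max_(i <- s) i).+1 => i /= si.
by rewrite ltnS; exact: leq_bigmax_seq.
Qed.

(** The default [x j] of [nth] makes the sequence follow [x] again after the inserted block. *)
Definition insert_at {X : Type} (x : nat -> X) (i : nat) (c : seq X) : nat -> X :=
  fun j => if j < i then x j else nth (x j) c (j - i).

Lemma extends_insert_at (X : Type) (x z : nat -> X) (i : nat) (c : seq X) :
  (forall j : 'I_(i + size c), z j = insert_at x i c j) ->
  extends (fun n => z (i + n)) c.
Proof.
move=> zE j; have ltj : i + j < i + size c by rewrite ltn_add2l.
rewrite (zE (Ordinal ltj)) /insert_at /= ltnNge leq_addr /= addKn.
by rewrite (tnth_nth (x (i + j))).
Qed.

Section sequence_space.
Variable X : discreteTopologicalType.
Local Notation seqX := (prod_topology (fun _ : nat => X)).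

(** Singletons of [X] are open, and only finitely many coordinates are constrained. *)
Lemma nbhs_cylinder (x : seqX) (k : nat) :
  nbhs x [set z : seqX | forall j : 'I_k, z j = x j].
Proof.
apply: (@filter_forall _ 'I_k (fun j => [set z : seqX | z j = x j]) _
  (nbhs_filter x)) => j.
exact: (@proj_continuous _ (fun _ : nat => X) (nat_of_ord j) x _
  (discrete_set1 (x j))).
Qed.

Lemma cvg_agree (y : nat -> seqX) (x : seqX) :
  (forall n j, j < n -> y n j = x j) -> y @ \oo --> x.
Proof.
move=> yx; apply/cvg_sup => N U [V] [[W] oW <-] WxN WU.
(* Coordinate [N] of [y n] is that of [x] as soon as [N < n]. *)
exists N.+1 => // n /= Nn; apply: WU => /=.
by rewrite yx.
Qed.

Lemma nowhere_dense_no_extension (J : set nat) (f : J -> seq X) (m : nat) :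
  infinite_set J ->
  nowhere_dense [set a : seqX | forall i : J,
    extends (fun n => a (\val i + n)) (f i) -> \val i < m].
Proof.
move=> Jinf; rewrite /nowhere_dense -subset0 => x.
set A := [set a | _] => xA.
(* The bound [n] keeps the first [n] terms of [x] intact, so that [y n] tends to [x]; the bound [m]
   contradicts membership in [A]. *)
have /choice[i iE] n : exists i : J, maxn n m <= \val i.
  have [i Ji le_i] := infinite_nat_unbounded J (maxn n m) Jinf.
  by exists (SigSub (mem_set Ji)).
pose y n : seqX := insert_at x (\val (i n)) (f (i n)).
have /cvg_agree yx n j : j < n -> y n j = x j.
  move=> jn; rewrite /y /insert_at (leq_trans jn) //.
  exact: leq_trans (leq_maxl _ _) (iE n).
have [n _ /(_ n (leqnn n)) cAy] := yx _ xA.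
(* This cylinder reaches the end of the inserted block, so its point [z] in [A] also carries
   [f (i n)] at [i n]. *)
have [z [Az zy]] := cAy _ (nbhs_cylinder (y n) (\val (i n) + size (f (i n)))).
have := Az _ (extends_insert_at _ _ _ _ _ zy).
by rewrite ltnNge (leq_trans (leq_maxr _ _) (iE n)).
Qed.

End sequence_space.

Lemma nowhere_denseS (T : topologicalType) (A B : set T) :
  A `<=` B -> nowhere_dense B -> nowhere_dense A.
Proof.
rewrite /nowhere_dense -!subset0 => AB; apply: subset_trans.
exact/interiorS/closureS.
Qed.

Theorem theorem1 (X : discreteTopologicalType) (X_neq0 : [set: X] !=set0)
    (S : set (prod_topology (fun _ : nat => X)))
    (S_second_category : second_category S)
    (J : set nat) (J_infinite : infinite_set J) (f : J -> seq X) :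
  exists a : nat -> X,
    S a /\
    infinite_set [set i : J | extends (fun n : nat => a (\val i + n)%N) (f i)].
Proof.
apply: contrapT => noa; apply: S_second_category.
pose N m := [set a : prod_topology (fun _ : nat => X) | forall i : J,
  extends (fun n => a (\val i + n)) (f i) -> \val i < m].
(* Intersecting with [S] makes the union equal to [S], as [first_category] demands. *)
exists (fun m => S `&` N m); split => [m|].
  apply: nowhere_denseS (@subIsetr _ _ _) _.
  exact: nowhere_dense_no_extension.
apply/seteqP; split => [a Sa|a [m _ []//]].
have /(finite_image \val)/finite_nat_bounded[m am] :
    finite_set [set i : J | extends (fun n => a (\val i + n)) (f i)].
  by apply: contrapT => ainf; apply: noa; exists a.
by exists m => //; split => // i ai; apply: am; exists i.
Qed.
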